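(* Let $\mathcal{A}$ be an $m$-th order $n$-dimensional P-tensor and let $\mathbf{q}\in\mathbb{R}^n$. Then the solution set of the tensor complementarity problem, i.e. the set of all $\mathbf{x}\in\mathbb{R}^n$ satisfying $$\mathbf{x}\ge \mathbf{0},\qquad \mathcal{A}\mathbf{x}^{m-1}+\mathbf{q}\ge \mathbf{0},\qquad \langle \mathbf{x},\mathcal{A}\mathbf{x}^{m-1}+\mathbf{q}\rangle=0,$$ is nonempty and compact.
   Context: An $m$-th order $n$-dimensional tensor ($m\ge 2$, $n\ge 1$) is a real array $\mathcal{A}=(a_{i_1\ldots i_m})$, $1\le i_1,\ldots,i_m\le n$ (not assumed symmetric). For $\mathbf{x}\in\mathbb{R}^n$, $\mathcal{A}\mathbf{x}^{m-1}\in\mathbb{R}^n$ is the vector with $i$-th entry $\sum_{i_2,\ldots,i_m=1}^n a_{i i_2\ldots i_m}x_{i_2}\cdots x_{i_m}$. Vector inequalities are entrywise and $\langle\cdot,\cdot\rangle$ is the standard inner product. $\mathcal{A}$ is a P-tensor if for each nonzero $\mathbf{x}\in\mathbb{R}^n$ there is an index $i$ with $x_i^{m-1}(\mathcal{A}\mathbf{x}^{m-1})_i>0$. *)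

(* Defs.v *)
From HB Require Import structures.
From mathcomp Require Import all_boot all_order all_algebra.
From mathcomp Require Import all_classical all_reals all_analysis.

Set Implicit Arguments.
Unset Strict Implicit.
Unset Printing Implicit Defensive.

Import Order.TTheory GRing.Theory Num.Theory.
Import numFieldNormedType.Exports.

Local Open Scope classical_set_scope.
Local Open Scope ring_scope.

Definition tensor (R : realType) (m n : nat) : Type := m.-tuple 'I_n -> R.

(* The i-th entry is the sum of a_t * x_(t_2) * ... * x_(t_m) over the
   multi-indices t = (t_1, ..., t_m) with t_1 = i. *)
Definition tensor_app (R : realType) (m n : nat) (A : tensor R m n)
    (x : 'rV[R]_n) : 'rV[R]_n :=
  \row_i \sum_(t : m.-tuple 'I_n | ohead t == Some i)
    A t * \prod_(j <- behead t) x ord0 j.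

Definition vec_ge0 (R : realType) (n : nat) (x : 'rV[R]_n) : Prop :=
  forall i : 'I_n, 0 <= x ord0 i.

Definition inner (R : realType) (n : nat) (x y : 'rV[R]_n) : R :=
  \sum_(i < n) x ord0 i * y ord0 i.

Definition P_tensor (R : realType) (m n : nat) (A : tensor R m n) : Prop :=
  forall x : 'rV[R]_n, x <> 0 ->
    exists i : 'I_n, 0 < x ord0 i ^+ m.-1 * tensor_app A x ord0 i.

Definition TCP_sol (R : realType) (m n : nat) (A : tensor R m n)
    (q : 'rV[R]_n) : set 'rV[R]_n :=
  [set x | [/\ vec_ge0 x, vec_ge0 (tensor_app A x + q) &
               inner x (tensor_app A x + q) = 0]].

(* Main.v *)
(* On the nonnegative orthant a P-tensor is semipositive: some x_i (A x^(m-1))_i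
   is positive unless x = 0.  By homogeneity and compactness of the simplex, any
   x >= 0 with x_i (A x^(m-1) + q)_i <= 0 for all i is bounded; this gives
   compactness.  For existence, solve the variational inequality of
   A x^(m-1) + q on a large simplex, with one slack coordinate on which the map
   is 0; by the bound the slack cannot vanish, and the solution is complementary.
   The variational inequality on the simplex (equivalent to Brouwer's theorem)
   comes from Scarf's combinatorial theorem on dominant sets of finitely many
   linear orders, proved by a parity argument and applied to finer and finer
   grids of the simplex, each grid point being coloured by the index of a
   smallest coordinate of the map. *)
Require Import Defs.
From HB Require Import structures.
From mathcomp Require Import all_boot all_order all_algebra.
From mathcomp Require Import zify lra.

Set Implicit Arguments.
Unset Strict Implicit.
Unset Printing Implicit Defensive.

(** * Scarf's theorem *)

Section DominantSets.

(* [d i] is a slack element: least in the [i]-th order and above all non-slack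
   elements in the others. *)
Variables (T I : finType) (u : I -> T -> nat) (c : T -> I) (d : I -> T) (t0 : T).
Hypothesis u_inj : forall i, injective (u i).
Hypothesis cdK : forall i, c (d i) = i.
Hypothesis u_min : forall i x, u i (d i) <= u i x.
Hypothesis u_max : forall k i x, x != d (c x) -> k != i -> u k x < u k (d i).
Hypothesis t0N : t0 != d (c t0).

(** Scarf's primitive sets: no element of [T] lies strictly above the minimum of [S] in all the
    orders at once. *)
Definition dominant (S : {set T}) : bool :=
  [forall y, exists i, forall x in S, u i y <= u i x].

Lemma dominantP (S : {set T}) :
  reflect (forall y, exists i, forall x, x \in S -> u i y <= u i x) (dominant S).
Proof.
apply: (iffP forallP) => H y; have := H y.
  by move/existsP=> [i /forall_inP]; exists i.
by move=> [i Hi]; apply/existsP; exists i; apply/forall_inP.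
Qed.

Lemma dominantS (S S' : {set T}) : S \subset S' -> dominant S' -> dominant S.
Proof.
move=> /subsetP sSS' /dominantP domS'; apply/dominantP => y.
by have [i Hi] := domS' y; exists i => x /sSS' /Hi.
Qed.

(** By dominance every element of [D] is its minimum in some order. There is one more order than
    elements, so exactly two orders share a minimum. An added element must become the minimum in one
    of these two, and each admits a single candidate. *)
Lemma card_pivots_internal (D : {set T}) (t : T) :
  dominant D -> #|D|.+1 = #|I| -> t \in D -> t != d (c t) ->
  #|[set x | (x \notin D) && dominant (x |: D)]| = 2.
Proof.
move=> domD cardD tD tN; move/dominantP: (domD) => domP.
have [mn mnD mnP] : exists2 mn : I -> T, forall i, mn i \in D &
    forall i x, x \in D -> u i (mn i) <= u i x.
  exists (fun i => [arg min_(x < t in D) u i x]) => i; first by case: arg_minnP.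
  by move=> x xD; case: arg_minnP => // y _; apply.
have mn_eq i x : x \in D -> (forall z, z \in D -> u i x <= u i z) -> x = mn i.
  move=> xD xmin; apply/(u_inj (i := i))/eqP.
  by rewrite eqn_leq xmin ?mnD //= mnP.
have mn_onto x : x \in D -> exists i, mn i = x.
  by move=> xD; have [i /(mn_eq _ _ xD)] := domP x; exists i.
have [i [j [ij mnij]]] : exists i j, i != j /\ mn i = mn j.
  have /injectivePn[i [j ij mnij]] : ~~ injectiveb mn.
    apply/negP => /injectiveP /card_imset - /(_ predT).
    have -> : mn @: predT = D.
      apply/setP => x; apply/imsetP/idP => [[i _ ->] //|/mn_onto[i <-]].
      by exists i.
    by move=> E; apply: (n_Sn #|I|); rewrite -{1}cardD E.
  by exists i; exists j.
(* Once one of two indices with the same minimum is dropped, the map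
   [i |-> min_i D] becomes a bijection onto [D]. *)
have mn_inj k : (forall x, x \in D -> exists2 l, l != k & mn l = x) ->
    {in [set~ k] &, injective mn}.
  move=> onto; apply/imset_injP/eqP; rewrite cardsC1 -cardD /=.
  congr #|pred_of_set _|; apply/setP => x; apply/imsetP/idP => [[l _ ->] //|].
  by case/onto => l lk <-; exists l; rewrite // !inE.
have onto_ne a b : a != b -> mn a = mn b ->
    forall x, x \in D -> exists2 l, l != a & mn l = x.
  move=> ab mnab x /mn_onto[l <-]; have [->|la] := eqVneq l a; last by exists l.
  by exists b => //; rewrite eq_sym.
(* Candidates for the new minimum in order [a]: they must exceed the old minima in all other orders.
   The non-slack [t] makes [d a] one of them. *)
pose M a := [pred y | [forall l, (l != a) ==> (u l (mn l) < u l y)]].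
pose top a := [arg max_(y > d a | M a y) u a y].
have MP a y : M a y -> forall l, l != a -> u l (mn l) < u l y.
  by move=> /forallP H l la; have /implyP := H l; apply.
have Md a : M a (d a).
  apply/forallP => l; apply/implyP => la.
  by apply: leq_ltn_trans (u_max tN la); apply: mnP.
have topM a : M a (top a) by rewrite /top; case: arg_maxnP.
have topP a y : M a y -> u a y <= u a (top a).
  by move=> My; rewrite /top; case: arg_maxnP => // z _; apply.
have M_le a y x : M a y -> x \in D -> u a y <= u a x.
  move=> My xD; have [l Hl] := domP y; have [<-|la] := eqVneq l a; first exact: Hl.
  by have := Hl _ (mnD l); rewrite leqNgt (MP _ _ My).
have good a b : a != b -> mn a = mn b ->
    (top a \notin D) && dominant (top a |: D).
  move=> ab mnab; have onto := onto_ne _ _ ab mnab; apply/andP; split.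
    apply/negP => /onto[l la E]; have := MP _ _ (topM a) _ la.
    by rewrite E ltnn.
  apply/dominantP => y; have [My|] := boolP (M a y).
    exists a => x /setU1P[->|xD]; first exact: topP.
    exact: M_le.
  rewrite negb_forall => /existsP[l]; rewrite negb_imply -leqNgt => /andP[la yl].
  exists l => x /setU1P[->|xD]; last by rewrite (leq_trans yl) ?mnP.
  by rewrite (leq_trans yl) // ltnW // (MP _ _ (topM a)).
have top_only a b x : a != b -> mn a = mn b -> x \notin D ->
    (forall y, exists i, forall z, z \in x |: D -> u i y <= u i z) ->
    (forall z, z \in D -> u a x <= u a z) -> x = top a.
  move=> ab mnab xD domx xmin.
  have inj := mn_inj _ (onto_ne _ _ ab mnab).
  have Mx : M a x.
    apply/forallP => l; apply/implyP => la.
    rewrite ltn_neqAle; apply/andP; split.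
      by apply/negP => /eqP/u_inj E; move: xD; rewrite -E mnD.
    (* In [x |: D] the element [mn l] is least in some order [k]. As [x] lies below [D] in order
       [a], [k] differs from [a], and injectivity gives [k = l]. *)
    have [k kP] := domx (mn l).
    have kE : mn l = mn k by apply: mn_eq => // z zD; apply: kP; rewrite setU1r.
    have ka : k != a.
      apply/eqP => ka; move: (kP x (setU11 _ _)); rewrite ka.
      move=> le1; have le2 := xmin _ (mnD l).
      have /u_inj E : u a x = u a (mn l) by apply/eqP; rewrite eqn_leq le1 le2.
      by move: xD; rewrite E mnD.
    have <- : k = l by apply: inj; rewrite ?inE.
    by have := kP x (setU11 _ _); rewrite kE.
  apply/(u_inj (i := a))/eqP; rewrite eqn_leq topP //=.
  have [k kP] := domx (top a); have [E|ka] := eqVneq k a.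
    by rewrite E in kP; apply/kP/setU11.
  have := kP _ (setU1r _ (mnD k)).
  by rewrite leqNgt (MP _ _ (topM a)).
have topij : top i != top j.
  apply/eqP => E; have := MP _ _ (topM j) _ ij; rewrite -E ltnNge.
  by rewrite M_le // topM.
suff -> : [set x | (x \notin D) && dominant (x |: D)] = [set top i; top j].
  by rewrite cards2 topij.
apply/setP => x; rewrite inE in_set2; apply/idP/idP; last first.
  case/orP => /eqP ->; first exact: good ij mnij.
  by apply: good (esym mnij); rewrite eq_sym.
(* If [x] is least in order [k], all of [D] consists of minima in the other orders, so [k] is one of
   the two indices that share a minimum. *)
move=> /andP[xD /dominantP domx]; have [k kP] := domx x.
have onto x' : x' \in D -> exists2 l, l != k & mn l = x'.
  move=> x'D; have [l lP] := domx x'; exists l.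
    apply/eqP => lk; have := lP _ (setU11 _ _); have := kP _ (setU1r _ x'D).
    rewrite lk => le1 le2.
    have /u_inj E : u k x = u k x' by apply/eqP; rewrite eqn_leq le1 le2.
    by move: xD; rewrite E x'D.
  by apply/esym/mn_eq => // z zD; apply: lP; rewrite setU1r.
have xmin z : z \in D -> u k x <= u k z by move=> zD; apply/kP/setU1r.
have : (k == i) || (k == j).
  apply: contraT; rewrite negb_or => /andP[ki kj].
  have := mn_inj _ onto i j; rewrite !inE eq_sym ki eq_sym kj.
  by move=> /(_ isT isT mnij) E; rewrite E eqxx in ij.
case/orP => /eqP E; rewrite E in xmin.
  by rewrite (top_only i j x) // eqxx.
by rewrite (top_only j i x) ?eqxx ?orbT // eq_sym.
Qed.

(** Each slack element of [D] is least in its own order, so only order [i0] can handle the elements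
    outside [D]. This forces [x] to be the [i0]-largest of them. *)
Lemma card_pivots_outer (i0 : I) (D : {set T}) : D = d @: [set~ i0] ->
  #|[set x | (x \notin D) && dominant (x |: D)]| = 1.
Proof.
move=> DE.
have dD k : k != i0 -> d k \in D.
  by move=> ki; rewrite DE; apply: imset_f; rewrite !inE.
have DP x : x \in D -> exists2 k, k != i0 & x = d k.
  by rewrite DE => /imsetP[k]; rewrite !inE; exists k.
have t0D : t0 \notin D.
  by apply/negP => /DP[k _ E]; move: t0N; rewrite E cdK eqxx.
have lt_dD y k : y \notin D -> k != i0 -> u i0 y < u i0 (d k).
  move=> yD ki; have [yE|yN] := eqVneq y (d (c y)); last by rewrite u_max // eq_sym.
  have [ci|ci] := eqVneq (c y) i0; last by rewrite yE dD in yD.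
  rewrite ltn_neqAle yE ci u_min andbT; apply: contra ki => /eqP/u_inj E.
  by rewrite -(cdK k) -E cdK.
pose x0 := [arg max_(y > t0 | y \notin D) u i0 y].
have [x0D x0P] : x0 \notin D /\ forall y, y \notin D -> u i0 y <= u i0 x0.
  by rewrite /x0; case: arg_maxnP.
suff -> : [set x | (x \notin D) && dominant (x |: D)] = [set x0] by rewrite cards1.
apply/setP => x; rewrite inE in_set1; apply/idP/eqP => [/andP[xD /dominantP domx]|->].
  apply: (u_inj (i := i0)); apply/eqP; rewrite eqn_leq x0P //=.
  have [k kP] := domx x0; have [E|ki] := eqVneq k i0.
    by rewrite E in kP; apply/kP/setU11.
  have /u_inj x0E : u k x0 = u k (d k).
    by apply/eqP; rewrite eqn_leq u_min kP // setU1r // dD.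
  by rewrite x0E dD in x0D.
rewrite x0D; apply/dominantP => y; have [yD|yD] := boolP (y \in D).
  by have [k _ ->] := DP _ yD; exists k => z _; apply: u_min.
exists i0 => z /setU1P[->|/DP[k ki ->]]; first exact: x0P.
exact/ltnW/lt_dD.
Qed.

(** If removing [x] leaves every colour but [i0] exactly once, the colour of [x] is not [i0] and
    recurs at a unique [x']. Then exactly [x] and [x'] can be removed, so the count is 0 or 2. *)
Lemma even_faces (i0 : I) (S : {set T}) :
  #|S| = #|I| -> c @: S != setT ->
  ~~ odd #|[set x in S | c @: (S :\ x) == [set~ i0]]|.
Proof.
move=> cardS cS.
set A := [set x in S | _]; have [->|[x]] := set_0Vmem A; first by rewrite cards0.
rewrite inE => /andP[xS /eqP cSx].
have inj : {in S :\ x &, injective c}.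
  by apply/imset_injP; rewrite cSx cardsC1 -cardS (cardsD1 x S) xS.
have SE : S = x |: S :\ x by rewrite setD1K.
have : c x \in [set~ i0].
  apply: contraR cS; rewrite !inE negbK => /eqP cx.
  by rewrite SE imsetU1 cSx cx setUCr.
rewrite -cSx => /imsetP[x' x'S cxx'].
have [x'x x'S1] : x' != x /\ x' \in S by move: x'S; rewrite !inE => /andP.
suff -> : A = [set x; x'].
  by rewrite cards2 eq_sym x'x.
apply/setP => z; rewrite inE in_set2.
have [->|zx] := eqVneq z x; first by rewrite xS cSx eqxx.
have [->|zx'] := eqVneq z x'.
  rewrite x'S1 /= -cSx; apply/eqP/setP => i; apply/imsetP/imsetP => -[y].
    rewrite !inE => /andP[yx' yS] ->; have [->|yx] := eqVneq y x.
      by exists x' => //; rewrite !inE x'x.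
    by exists y => //; rewrite !inE yx.
  rewrite !inE => /andP[yx yS] ->; have [->|yx'] := eqVneq y x'.
    by exists x => //; rewrite !inE eq_sym x'x.
  by exists y => //; rewrite !inE yx'.
apply/negbTE/negP => /andP[zS /eqP E].
have zSx : z \in S :\ x by rewrite !inE zx.
have : c z \in c @: (S :\ z) by rewrite E -cSx imset_f.
move=> /imsetP[y]; rewrite !inE => /andP[yz yS] czy.
have [yx|yx] := eqVneq y x.
  have : z = x' by apply: inj => //; rewrite czy yx.
  by move/eqP; rewrite (negbTE zx').
have : z = y by apply: inj => //; rewrite !inE yx.
by move/eqP; rewrite eq_sym (negbTE yz).
Qed.

Lemma colourful_dominant_set :
  exists2 S : {set T}, dominant S & c @: S = setT.
Proof.
pose i0 := c t0.
have [/existsP[S /andP[domS /eqP cS]]|none] :=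
  boolP [exists S : {set T}, dominant S && (c @: S == setT)]; first by exists S.
have {}none S : dominant S -> c @: S != setT.
  by move=> domS; apply: contra none => cS; apply/existsP; exists S; rewrite domS.
(* Pairs [(S, x)] are counted modulo 2: grouped by [S] they are even in number
   when no [S] is colourful, grouped by the face [S :\ x] they are odd, the only
   face lying in a single dominant set being the one made of slack elements. *)
pose W (S : {set T}) x :=
  [&& x \in S, dominant S, #|S| == #|I| & c @: (S :\ x) == [set~ i0]].
have sum_even J (P : pred J) (r : seq J) (F : J -> nat) :
    (forall j, P j -> ~~ odd (F j)) -> ~~ odd (\sum_(j <- r | P j) F j).
  move=> H; apply: (big_ind (fun k => ~~ odd k)) => // a b.
  by rewrite oddD => /negbTE -> /negbTE ->.
have even : ~~ odd (\sum_(S : {set T}) \sum_(x | W S x) 1).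
  apply: sum_even => S _; rewrite sum1_card.
  have [/andP[domS /eqP cardS]|no] := boolP (dominant S && (#|S| == #|I|)).
    have := even_faces i0 cardS (none _ domS); congr (~~ odd _).
    by apply: eq_card => x; rewrite inE [in RHS]unfold_in /= /W domS cardS eqxx.
  rewrite eq_card0 // => x; rewrite unfold_in /W; apply: contraNF no.
  by case/and4P => _ -> ->.
have odd1 : odd (\sum_(S : {set T}) \sum_(x | W S x) 1).
  rewrite (exchange_big_dep predT) //=.
  under eq_bigr => x _.
    rewrite (reindex_onto (fun D => x |: D) (fun S => S :\ x)); last first.
      by move=> S /and4P[xS _ _ _]; rewrite setD1K.
    over.
  rewrite (exchange_big_dep predT) //=.
  pose D0 := d @: [set~ i0].
  have WE D x : W (x |: D) x && ((x |: D) :\ x == D) =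
    [&& #|D|.+1 == #|I|, c @: D == [set~ i0] & (x \notin D) && dominant (x |: D)].
    have [xD|xD] := boolP (x \in D).
      rewrite !andbF; apply/negbTE; rewrite negb_and; apply/orP; right.
      by apply/negP => /eqP E; move: xD; rewrite -E !inE eqxx.
    by rewrite setU1K // eqxx andbT /W setU11 setU1K // cardsU1 xD add1n /= andbC -andbA.
  have d_inj : injective d by apply: can_inj cdK.
  rewrite (bigD1 D0) //= oddD.
  rewrite [X in odd X (+) _](_ : _ = 1).
    rewrite addTb; apply: sum_even => D DD0; rewrite sum1_card.
    have [/andP[/eqP cardD /eqP cD]|no] :=
      boolP ((#|D|.+1 == #|I|) && (c @: D == [set~ i0])); last first.
      rewrite eq_card0 // => x; rewrite unfold_in WE; apply: contraNF no.
      by case/and3P => -> ->.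
    (* A face made of slack elements only equals [d @: (c @: D)], which is [D0]. *)
    have [t tD tN] : exists2 t, t \in D & t != d (c t).
      apply/exists_inP; apply: contraR DD0 => /exists_inPn allD.
      have dK x : x \in D -> d (c x) = x.
        by move=> /allD /negPn /eqP.
      rewrite /D0 -cD -imset_comp; apply/eqP/setP => x; apply/idP/imsetP.
        by move=> xD; exists x => //=; rewrite dK.
      by case=> y yD ->; rewrite /= dK.
    have [domD|ndomD] := boolP (dominant D).
      rewrite (_ : #|_| = 2) // -(card_pivots_internal domD cardD tD tN).
      by apply: eq_card => x; rewrite !inE unfold_in WE cardD cD !eqxx.
    rewrite eq_card0 // => x; rewrite unfold_in WE; apply: contraNF ndomD.
    by case/and4P => _ _ _; apply/dominantS/subsetU1.
  rewrite sum1_card -(card_pivots_outer (erefl D0)); apply: eq_card => x.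
  rewrite !inE unfold_in WE /D0 card_imset // cardsC1.
  rewrite prednK ?eqxx /=; last by apply/card_gt0P; exists i0.
  rewrite -imset_comp (eq_imset (g := id)) ?imset_id ?eqxx //.
by case: (negP even).
Qed.

End DominantSets.

(** A slack element [inr i] of colour [i] is adjoined for each order. In a colourful dominant set,
    [C] collects the orders whose slack is absent, so their colours come from [T]. *)
Lemma scarf (T I : finType) (v : I -> T -> nat) (c : T -> I) (t0 : T) :
  exists (s : {set T}) (C : {set I}),
    [/\ s != set0, forall i, i \in C -> exists2 x, x \in s & c x = i &
        forall y, exists2 i, i \in C & forall x, x \in s -> v i y <= v i x].
Proof.
pose B := \max_i \max_x v i x.
have leB i x : v i x <= B.
  apply: (leq_trans (leq_bigmax (F := fun x => v i x) x)).
  exact: (leq_bigmax (F := fun i => \max_x v i x) i).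
pose c' (z : T + I) := match z with inl x => c x | inr i => i end.
(* Weights from [T] lie between 1 and [B.+1], strictly between the two slack values. *)
pose w i (z : T + I) :=
  match z with inl x => (v i x).+1 | inr l => if l == i then 0 else B.+2 end.
(* Ties are broken by an arbitrary enumeration. *)
pose u i (z : T + I) := w i z * #|{: T + I}| + enum_rank z.
have u_lt i z z' : w i z < w i z' -> u i z < u i z'.
  move=> lt_w; apply: (@leq_trans ((w i z).+1 * #|{: T + I}|)).
    by rewrite mulSnr ltn_add2l.
  by apply: leq_trans (leq_addr _ _); rewrite leq_mul2r lt_w orbT.
have u_le i z z' : u i z <= u i z' -> w i z <= w i z'.
  by rewrite leqNgt => H; rewrite leqNgt; apply: contra H; apply: u_lt.
have u_inj i : injective (u i).
  move=> z z' E; have Ew : w i z = w i z'.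
    by apply/eqP; rewrite eqn_leq !u_le // E.
  by move: E; rewrite /u Ew => /addnI /ord_inj /enum_rank_inj.
have u_min i z : u i (inr i) <= u i z.
  case: z => [x|l]; first by apply/ltnW/u_lt; rewrite /= eqxx.
  have [->//|li] := eqVneq l i; apply/ltnW/u_lt.
  by rewrite /= eqxx (negbTE li).
have u_max k i z : z != inr (c' z) -> k != i -> u k z < u k (inr i).
  case: z => [x|l] /=; last by rewrite eqxx.
  by move=> _ ki; apply: u_lt; rewrite /= eq_sym (negbTE ki) !ltnS.
have t0N : inl t0 != inr (c' (inl t0)) :> T + I by [].
have [S /dominantP domS cS] :=
  colourful_dominant_set (c := c') (d := inr) u_inj (fun=> erefl) u_min u_max t0N.
have key y : exists2 i, inr i \notin S & forall z, z \in S -> w i (inl y) <= w i z.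
  have [i Hi] := domS (inl y); exists i; last by move=> z /Hi/u_le.
  by apply/negP => /Hi/u_le /=; rewrite eqxx ltn0.
exists [set x | inl x \in S], [set i | inr i \notin S]; split.
- have [i iS _] := key t0; apply/set0Pn.
  have : i \in c' @: S by rewrite cS.
  case/imsetP => -[x|l] zS /= E; first by exists x; rewrite inE.
  by rewrite E zS in iS.
- move=> i; rewrite inE => iS; have : i \in c' @: S by rewrite cS.
  case/imsetP => -[x|l] zS /= E; first by exists x; rewrite ?inE.
  by rewrite E zS in iS.
- move=> y; have [i iS Hi] := key y; exists i; first by rewrite inE.
  by move=> x; rewrite inE => /Hi.
Qed.

(** The orders are the coordinates. Dominance makes the coordinate minima over [s], for indices in
    [C], sum to nearly [N]; since each point sums to [N], the points of [s] are close together and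
    small outside [C]. *)
Lemma scarf_grid (n N : nat) (c : {ffun 'I_n -> 'I_N.+1} -> 'I_n) : 0 < n ->
  exists k : {ffun 'I_n -> 'I_N.+1}, \sum_i k i = N /\
    forall i, k i <= n \/ exists k' : {ffun 'I_n -> 'I_N.+1},
      [/\ \sum_i k' i = N, c k' = i &
          forall j, k' j <= k j + n /\ k j <= k' j + n].
Proof.
move=> n_gt0; pose T := {k : {ffun 'I_n -> 'I_N.+1} | \sum_i k i == N}.
pose i1 := Ordinal n_gt0.
have build (f : 'I_n -> nat) (C : {set 'I_n}) i0 :
    i0 \in C -> \sum_(i in C) f i <= N ->
    exists y : T, forall i, i \in C -> f i <= val y i.
  move=> i0C fN.
  (* The surplus that brings the total up to [N] is put on [i0]. *)
  pose g i := if i \in C then f i + (if i == i0 then N - \sum_(i in C) f i else 0)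
    else 0.
  have gN : \sum_i g i = N.
    rewrite -big_mkcond big_split /= -big_mkcondr /=.
    rewrite [X in _ + X](big_pred1 i0); first by rewrite subnKC.
    by move=> i /=; case: eqVneq => [->|]; rewrite ?i0C ?andbF.
  have gle i : g i < N.+1 by rewrite ltnS -gN (bigD1 i) //= leq_addr.
  have gP : \sum_i [ffun i => Ordinal (gle i)] i == N.
    by under eq_bigr => i _ do rewrite ffunE /=; rewrite gN.
  exists (exist (fun k : {ffun 'I_n -> 'I_N.+1} => \sum_i k i == N) _ gP).
  by move=> i iC; rewrite /= ffunE /= /g iC; exact: leq_addr.
have [t0 _] := build (fun=> 0) [set i1] i1 (set11 _) ltac:(by rewrite big1).
have [s [C [/set0Pn[k ks] colP domP]]] :=
  scarf (fun i (k : T) => val k i : nat) (fun k : T => c (val k)) t0.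
pose m i := val [arg min_(x < k in s) (val x i : nat)] i : nat.
have m_le i x : x \in s -> m i <= val x i.
  by rewrite /m; case: arg_minnP => // y _ H /H.
have m_ex i : exists2 x, x \in s & m i = val x i.
  by rewrite /m; case: arg_minnP => // y; exists y.
(* Otherwise all the minima over [s] could be raised by one inside the grid. *)
have sum_m : N < \sum_(i in C) (m i).+1.
  rewrite ltnNge; apply/negP => le_N; have [i iC _] := domP k.
  have [y yP] := build _ _ _ iC le_N; have [l lC lP] := domP y.
  have [x xs mx] := m_ex l; have := lP _ xs.
  by rewrite -mx leqNgt yP.
pose r i := if i \in C then m i else 0.
have r_le x i : x \in s -> r i <= val x i.
  by rewrite /r; case: ifP => // _; apply: m_le.
have le_r x i : x \in s -> val x i <= r i + n.
  move=> xs; have : \sum_j val x j <= \sum_j r j + n.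
    rewrite (eqP (valP x)); apply/ltnW/(leq_trans sum_m).
    rewrite /r -big_mkcond; under eq_bigr => j _ do rewrite -addn1.
    by rewrite big_split sum1_card leq_add2l -[X in _ <= X]card_ord max_card.
  rewrite (bigD1 i) //= [X in _ <= X + _](bigD1 i) //=.
  have : \sum_(j < n | j != i) r j <= \sum_(j < n | j != i) val x j.
    by apply: leq_sum => j _; apply: r_le.
  have aux a b s1 s2 e : s1 <= s2 -> a + s2 <= b + s1 + e -> a <= b + e by lia.
  exact: aux.
exists (val k); split; first exact/eqP/(valP k).
move=> i; have [/colP[x xs cx]|iC] := boolP (i \in C); last first.
  by left; have := le_r _ i ks; rewrite /r (negbTE iC).
right; exists (val x); split=> // [|j]; first exact/eqP/(valP x).
by split; apply: leq_trans (le_r _ j _) _ => //; rewrite leq_add2r r_le.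
Qed.

(** * Variational inequalities on the simplex *)

(* Imported only here: its [classical_sets] lemmas shadow those of [finset]. *)
From mathcomp Require Import all_classical all_reals all_analysis.

Import Order.TTheory GRing.Theory Num.Theory.
Import numFieldNormedType.Exports.

Local Open Scope classical_set_scope.
Local Open Scope ring_scope.

(** * Continuity, and compactness in the nonnegative orthant *)

Lemma continuous_sum (R : realType) (T : topologicalType) (J : Type) (r : seq J)
    (P : pred J) (F : J -> T -> R) :
  (forall j, continuous (F j)) -> continuous (fun x => \sum_(j <- r | P j) F j x).
Proof. by move=> cF; apply: continuous_big => // x; exact: add_continuous. Qed.

Lemma continuous_prod (R : realType) (T : topologicalType) (J : Type) (r : seq J)
    (P : pred J) (F : J -> T -> R) :
  (forall j, continuous (F j)) -> continuous (fun x => \prod_(j <- r | P j) F j x).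
Proof. by move=> cF; apply: continuous_big => // x; exact: mul_continuous. Qed.

Definition simplex (R : realType) (n : nat) : set 'rV[R]_n :=
  [set x | vec_ge0 x /\ \sum_i x ord0 i = 1].

Arguments simplex : clear implicits.

Lemma closed_vec_ge0 (R : realType) (n : nat) (T : topologicalType) (f : T -> 'rV[R]_n) :
  (forall i, continuous (fun x => f x ord0 i)) -> closed [set x | vec_ge0 (f x)].
Proof.
move=> cf.
have -> : [set x | vec_ge0 (f x)] =
    \bigcap_(i in [set: 'I_n]) [set x | 0 <= f x ord0 i].
  by apply/seteqP; split=> [x H i _|x H i]; exact: H.
apply: closed_bigI => i _.
apply: (@preimage_closed _ _ (fun x => f x ord0 i) [set y | 0 <= y]);
  last exact: closed_ge.
by move=> x _; exact: cf.
Qed.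

Lemma compact_vec_ge0_sum (R : realType) (n : nat) (B : R) (A : set 'rV[R]_n) :
  closed A -> (forall x, A x -> vec_ge0 x /\ \sum_i x ord0 i <= B) -> compact A.
Proof.
move=> clA AP.
apply: (@subclosed_compact _ A
  [set x : 'rV[R]_n | forall i, `[0, B]%classic (x ord0 i)]) => //.
  by apply: (@rV_compact _ n (fun=> `[0, B]%classic)) => i; exact: segment_compact.
move=> x /AP[x0 xB] i /=; rewrite in_itv /= x0 /=; apply: le_trans xB.
by rewrite (bigD1 i) //= lerDl sumr_ge0.
Qed.

Lemma compact_simplex (R : realType) (n : nat) : compact (simplex R n).
Proof.
apply: (@compact_vec_ge0_sum _ _ 1) => [|x [x0 ->] //].
apply: closedI; first by apply: closed_vec_ge0 => i; exact: coord_continuous.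
apply: (@preimage_closed _ _ (fun x : 'rV[R]_n => \sum_i x ord0 i) [set y | y = 1]);
  last exact: closed_eq.
by move=> x _; apply: continuous_sum => i; exact: coord_continuous.
Qed.

Lemma simplex_approx (R : realType) (n N : nat) (g : 'I_n -> 'rV[R]_n -> R) : (0 < n)%N ->
  exists x : 'rV[R]_n, simplex R n x /\ forall i,
    x ord0 i <= n%:R / N.+1%:R \/
    exists x' : 'rV[R]_n, (forall j, g i x' <= g j x') /\
      forall j, `|x' ord0 j - x ord0 j| <= n%:R / N.+1%:R.
Proof.
move=> n0; pose i1 := Ordinal n0.
(* Grid points have total [N.+1], which keeps the denominator nonzero for every [N]. *)
pose pt (k : {ffun 'I_n -> 'I_N.+2}) : 'rV[R]_n := \row_j ((k j)%:R / N.+1%:R).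
pose c k := [arg min_(i < i1) g i (pt k)]%O.
have cP k j : g (c k) (pt k) <= g j (pt k) by rewrite /c; case: arg_minP => // i _; apply.
have N0 : 0 < N.+1%:R^-1 :> R by rewrite invr_gt0 ltr0Sn.
have [k [sumk kP]] := scarf_grid c n0.
exists (pt k); split; first split.
- by move=> i; rewrite mxE divr_ge0.
- under eq_bigr do rewrite mxE.
  by rewrite -mulr_suml -natr_sum sumk divff // pnatr_eq0.
move=> i; have [le_n|[k' [_ <- dk]]] := kP i.
  by left; rewrite mxE ler_pM2r // ler_nat.
right; exists (pt k'); split => // j; have [] := dk j.
rewrite -!(ler_nat R) !natrD => k1 k2.
rewrite !mxE -mulrBl normrM (gtr0_norm N0) ler_pM2r // ler_norml; lra.
Qed.

(* KKM for the simplex, in the form of a variational inequality. *)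
Lemma simplex_variational (R : realType) (n : nat) (g : 'I_n -> 'rV[R]_n -> R) :
  (0 < n)%N -> (forall i, continuous (g i)) ->
  exists2 x : 'rV[R]_n, simplex R n x &
    forall i j, 0 < x ord0 i -> g i x <= g j x.
Proof.
move=> n0 cg.
have [x_ x_P] := choice (fun N => simplex_approx N g n0).
have [x [xS xcl]] : simplex R n `&` cluster (x_ @ \oo) !=set0.
  apply: compact_simplex; exists 0%N => // N _; exact: (x_P N).1.
(* A strict violation at the cluster point persists nearby, where coordinate [i] also stays away
   from 0. The approximation then yields a nearby point minimizing [g] at index [i], a
   contradiction. *)
exists x => // i j xi; rewrite leNgt; apply/negP => gji.
have near_gt (h : 'rV[R]_n -> R) y :
    continuous h -> y < h x -> \forall z \near x, y < h z.
  by move=> ch yx; have := cvgr_gt (h x) (ch x); apply.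
have near_xi : \forall z \near x, x ord0 i / 2 < (z : 'rV[R]_n) ord0 i.
  apply: (near_gt (fun z : 'rV[R]_n => z ord0 i)); first exact: coord_continuous.
  by lra.
have near_g : \forall z \near x, 0 < g i z - g j z.
  apply: (near_gt (fun z => g i z - g j z)); last by rewrite subr_gt0.
  by move=> z; exact: (cvgB (cg i z) (cg j z)).
have [e /= e0 eP] := (nbhs_ballP _ _).1 (filterI near_xi near_g).
(* The first bound keeps [x'] within [e] of [x]; the second excludes the small-coordinate
   alternative. *)
pose de := Num.min (e / 2) (x ord0 i / 2).
have de0 : 0 < de by rewrite lt_min !divr_gt0.
have small : \forall N \near \oo, n%:R / N.+1%:R < de.
  have [N _ NP] := near_infty_natSinv_lt (PosNum (divr_gt0 de0 (ltr0Sn R n))).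
  exists N => // k /NP /=; rewrite ltr_pdivlMr ?ltr0Sn // mulrC.
  by apply: le_lt_trans; rewrite ler_pM2r ?invr_gt0 ?ltr0Sn // ler_nat.
have [N0 _ N0P] := small.
have [y [[N N0N <-] By]] : (x_ @` [set N | (N0 <= N)%N]) `&` ball x (e / 2) !=set0.
  apply: xcl; last by apply: nbhsx_ballx; rewrite divr_gt0.
  by exists N0 => // N N0N; exists N.
have := N0P _ N0N; rewrite /= lt_min => /andP[Ne Nx].
have sub_ball z : ball x (e / 2) z -> ball x e z.
  by apply: le_ball; lra.
have [_ /(_ i)[le_n|[x' [gx' dx']]]] := x_P N.
  by have [/= + _] := eP _ (sub_ball _ By); rewrite ltNge (le_trans le_n (ltW Nx)).
have Bx' : ball x e x'.
  rewrite (splitr e); apply: ball_triangle By _; split; first by rewrite divr_gt0.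
  move=> a b; rewrite (ord1 a) /ball /= distrC; exact: le_lt_trans (dx' b) Ne.
have [_ /=] := eP _ Bx'; rewrite subr_gt0 ltNge => /negP; apply; exact: gx'.
Qed.

(** * Tensors *)

Section Tensor.
Variables (R : realType) (m n : nat) (A : tensor R m n).

Lemma tensor_appZ (a : R) (x : 'rV[R]_n) :
  tensor_app A (a *: x) = a ^+ m.-1 *: tensor_app A x.
Proof.
apply/rowP => i; rewrite !mxE mulr_sumr; apply: eq_bigr => t _.
rewrite mulrCA; congr (_ * _); under eq_bigr do rewrite mxE.
by rewrite big_split /= big_const_seq count_predT size_behead size_tuple iter_mulr_1.
Qed.

Lemma continuous_tensor_app (T : topologicalType) (f : T -> 'rV[R]_n) (i : 'I_n) :
  (forall j, continuous (fun z => f z ord0 j)) ->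
  continuous (fun z => tensor_app A (f z) ord0 i).
Proof.
move=> cf; under eq_fun do rewrite mxE.
apply: continuous_sum => t z.
exact: (cvgM (cvg_cst _) (continuous_prod (fun j => cf j) (x := z))).
Qed.

Hypothesis (hm : (2 <= m)%N) (hA : P_tensor A).

(** Since [m.-1] is positive, the index given by the P-property has a positive coordinate, and its
    power can be traded for the coordinate itself. *)
Lemma P_tensor_semipositive (x : 'rV[R]_n) : vec_ge0 x -> x <> 0 ->
  exists i, 0 < x ord0 i * tensor_app A x ord0 i.
Proof.
move=> x0 /hA[i xFi]; exists i.
have xi0 : 0 < x ord0 i.
  rewrite lt_def x0 andbT; apply: contraTneq xFi => ->.
  by rewrite expr0n gtn_eqF ?mul0r ?ltxx // -subn1 subn_gt0.
by move: xFi; rewrite !pmulr_rgt0 // exprn_gt0.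
Qed.

(* By homogeneity, [x / s] with [s] the coordinate sum of [x] lies in the
   simplex, where [\sum_i max(0, x_i (A x^(m-1))_i)] has a positive minimum. *)
Lemma complementarity_bound (q : 'rV[R]_n) : exists B : R,
  forall x, vec_ge0 x -> (forall i, x ord0 i * (tensor_app A x + q) ord0 i <= 0) ->
  \sum_i x ord0 i <= B.
Proof.
have normalize (x : 'rV[R]_n) : vec_ge0 x -> 0 < \sum_i x ord0 i ->
    simplex R n ((\sum_i x ord0 i)^-1 *: x).
  move=> x0 s0; split; first by move=> i; rewrite mxE mulr_ge0 ?invr_ge0 // ltW.
  by under eq_bigr do rewrite mxE; rewrite -mulr_sumr mulVf ?gt_eqF.
have [ne|no] := pselect (simplex R n !=set0); last first.
  exists 0 => x x0 _; rewrite leNgt; apply/negP => s0.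
  by apply: no; eexists; exact: normalize s0.
pose phi (y : 'rV[R]_n) := \sum_i Num.max 0 (y ord0 i * tensor_app A y ord0 i).
have ctensor i : continuous (fun x : 'rV[R]_n => tensor_app A x ord0 i).
  by apply: continuous_tensor_app => j; exact: coord_continuous.
have cphi : continuous phi.
  apply: continuous_sum => i y.
  apply: (@continuous_max _ _ (cst 0)
    (fun y : 'rV[R]_n => y ord0 i * tensor_app A y ord0 i)).
    exact: cst_continuous.
  exact: (cvgM (@coord_continuous _ _ _ ord0 i y) (ctensor i y)).
have [y0 y0S y0P] := EVT_min_rV ne (@compact_simplex R n) (continuous_subspaceT cphi).
move: y0S; rewrite inE => -[y00 y0s].
have delta0 : 0 < phi y0.
  have [|i xFi] := P_tensor_semipositive y00.
    move=> E; move: y0s; rewrite E big1 => [/eqP|i _]; last by rewrite mxE.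
    by rewrite eq_sym oner_eq0.
  rewrite /phi (bigD1 i) //=; apply: ltr_pwDl; first by rewrite lt_max xFi orbT.
  by apply: sumr_ge0 => j _; rewrite le_max lexx.
(* The summand 1 forces [s > 1], hence [s <= s ^+ m.-1]; the quotient comes from
   [s * phi y0 <= \sum_i |q_i|]. *)
exists (1 + (\sum_i `|q ord0 i|) / phi y0) => x x0 xP.
rewrite leNgt; apply/negP; set s := \sum_i x ord0 i => lt_s.
have Q0 : 0 <= \sum_i `|q ord0 i| by apply: sumr_ge0.
have s1 : 1 < s by apply: le_lt_trans lt_s; rewrite lerDl divr_ge0 // ltW.
have s0 : 0 < s by apply: lt_trans s1.
have [y yS xE] : exists2 y, simplex R n y & x = s *: y.
  by exists (s^-1 *: x); [exact: normalize | rewrite scalerA divff ?scale1r ?gt_eqF].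
have {}xP i : y ord0 i * (s ^+ m.-1 * tensor_app A y ord0 i + q ord0 i) <= 0.
  by have := xP i; rewrite xE tensor_appZ !mxE -mulrA pmulr_rle0.
have y1 i : y ord0 i <= 1.
  rewrite -yS.2 (bigD1 i) //= lerDl; apply: sumr_ge0 => j _; exact: (yS.1 j).
have : s * phi y <= \sum_i `|q ord0 i|.
  (* Where the product is nonnegative, [s] times it is at most [s ^+ m.-1] times it, hence at most
     [- y_i q_i], and [y_i <= 1]. *)
  rewrite mulr_sumr; apply: ler_sum => i _; rewrite maxEle.
  case: ifP => [a0|_]; last by rewrite mulr0.
  apply: (@le_trans _ _ (s ^+ m.-1 * (y ord0 i * tensor_app A y ord0 i))).
    rewrite ler_wpM2r // -{1}(expr1 s) ler_eXn2l // -ltnS prednK //.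
    exact: ltn_trans hm.
  have := xP i; rewrite mulrDr mulrCA -lerBrDr sub0r => /le_trans; apply.
  apply: le_trans (ler_norm _) _; rewrite normrN normrM -[leRHS]mul1r.
  by rewrite ler_wpM2r // ger0_norm //; exact: yS.1.
have : s * phi y0 <= s * phi y by rewrite ler_pM2l // y0P // inE.
move=> /le_trans /[apply]; rewrite -ler_pdivlMr // leNgt => /negP; apply.
by apply: le_lt_trans lt_s; rewrite lerDr.
Qed.

End Tensor.

(** * Compactness and existence for the complementarity problem *)

Theorem theorem6p2 (R : realType) (m n : nat) (hm : (2 <= m)%N) (hn : (1 <= n)%N)
    (A : tensor R m n) (hA : P_tensor A) (q : 'rV[R]_n) :
  TCP_sol A q !=set0 /\ compact (TCP_sol A q).
Proof.
have [B BP] := complementarity_bound hm hA q.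
split; last first.
  apply: (@compact_vec_ge0_sum _ _ B) => [|x [x0 Fx0 xF]]; last first.
    split=> //; apply: BP => // i.
    by rewrite (psumr_eq0P _ xF) // => j _; rewrite mulr_ge0.
  have cF i : continuous (fun x : 'rV[R]_n => (tensor_app A x + q) ord0 i).
    under eq_fun do rewrite mxE; move=> x.
    have ctensor := continuous_tensor_app (A := A) (f := id) (i := i)
      (fun j => @coord_continuous _ _ _ ord0 j).
    exact: (cvgD (ctensor x) (cvg_cst _)).
  have -> : TCP_sol A q = [set x | vec_ge0 x] `&` [set x | vec_ge0 (tensor_app A x + q)]
      `&` [set x | inner x (tensor_app A x + q) = 0].
    by apply/seteqP; split=> [x [] //|x [[]] //].
  apply: closedI; first apply: closedI.
  - by apply: closed_vec_ge0 => i; exact: coord_continuous.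
  - exact: closed_vec_ge0.
  - apply: (@preimage_closed _ _ (fun x => inner x (tensor_app A x + q)) [set y | y = 0]).
      move=> x _; apply: continuous_sum => i z.
      exact: (cvgM (@coord_continuous _ _ _ ord0 i z) (cF i z)).
    exact: closed_eq.
(* The size of the simplex: positive and strictly above the bound [B]. *)
pose r := `|B| + 1.
pose X (z : 'rV[R]_n.+1) : 'rV[R]_n := \row_j (r * z ord0 (lift ord0 j)).
(* The extra coordinate [ord0] is a slack variable with value [0]; a
   positive slack in the solution is what makes it complementary. *)
pose g (i : 'I_n.+1) z :=
  if unlift ord0 i is Some j then (tensor_app A (X z) + q) ord0 j else 0.
have cg i : continuous (g i).
  rewrite /g; case: unlift => [j|] z; last exact: cst_continuous.
  under eq_fun do rewrite mxE.
  have cX k : continuous (fun z => X z ord0 k).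
    move=> y; under eq_fun do rewrite mxE.
    exact: (cvgM (cvg_cst _) (@coord_continuous _ _ _ ord0 _ y)).
  exact: (cvgD (continuous_tensor_app (A := A) cX (i := j) (x := z)) (cvg_cst _)).
have [z [z0 z1] zP] := simplex_variational (ltn0Sn n) cg.
have r0 : 0 < r by rewrite ltr_wpDl.
have X0 : vec_ge0 (X z) by move=> j; rewrite mxE mulr_ge0 // ltW.
have g0 : g ord0 z = 0 by rewrite /g unlift_none.
have gS j : g (lift ord0 j) z = (tensor_app A (X z) + q) ord0 j by rewrite /g liftK.
have Xpos j : X z ord0 j != 0 -> 0 < z ord0 (lift ord0 j).
  by rewrite lt_def z0 andbT; apply: contraNneq => E; rewrite mxE E mulr0.
(* A positive coordinate carries a minimal value of [g], hence one at most the slack value 0. *)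
have Xle j : X z ord0 j * (tensor_app A (X z) + q) ord0 j <= 0.
  have [->|/Xpos zj] := eqVneq (X z ord0 j) 0; first by rewrite mul0r.
  by rewrite mulr_ge0_le0 // -gS -g0 zP.
(* With zero slack the coordinates of [X z] would sum to [r], beyond [B]. *)
have slack : 0 < z ord0 ord0.
  rewrite lt_def z0 andbT; apply/eqP => zE.
  have := BP _ X0 Xle; under eq_bigr do rewrite mxE.
  rewrite -mulr_sumr; move: z1; rewrite big_ord_recl zE add0r => ->.
  by rewrite mulr1 leNgt ltr_pwDr // ler_norm.
(* Positive slack makes 0 the minimum of the [g i z]. *)
have F0 : vec_ge0 (tensor_app A (X z) + q) by move=> j; rewrite -gS -g0 zP.
exists (X z); split => //; rewrite /inner big1 // => j _.
by apply/eqP; rewrite eq_le Xle mulr_ge0.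
Qed.
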